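(* There is an almost rich closed subspace of the real space $L_1[0,1]$ which fails the Daugavet property and hence fails to be rich. Thus, on $L_1[0,1]$ the class of strong Daugavet operators does not coincide with the class of narrow operators.
   Context: All Banach spaces are real; $S(X)$ is the unit sphere of $X$. An operator on $X$ is a bounded linear operator from $X$ into some Banach space. $X$ has the Daugavet property if $\|\mathrm{Id}+R\|=1+\|R\|$ for every rank-one operator $R\colon X\to X$ (the space $L_1[0,1]$ has this property). For operators $T_1\colon X\to Y_1$, $T_2\colon X\to Y_2$ define $T_1\mathbin{\tilde+}T_2\colon X\to Y_1\oplus_1Y_2$, $x\mapsto(T_1x,T_2x)$, so $\|(T_1\mathbin{\tilde+}T_2)x\|=\|T_1x\|+\|T_2x\|$. $T$ is a strong Daugavet operator if for all $x,y\in S(X)$ and $\varepsilon>0$ there is $z\in S(X)$ with $\|T(z-y)\|<\varepsilon$ and $\|z+x\|>2-\varepsilon$. $T$ is narrow if $T\mathbin{\tilde+}x^*$ is a strong Daugavet operator for every $x^*\in X^*$. A closed subspace $Y$ of a Banach space $X$ with the Daugavet property is almost rich if the quotient map $q\colon X\to X/Y$ is a strong Daugavet operator, and rich if $q$ is narrow. *)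

(* Defs.v *)
From HB Require Import structures.
From mathcomp Require Import all_boot all_order all_algebra.
From mathcomp Require Import all_classical all_reals all_analysis measurable_realfun.
From mathcomp Require Import ring lra.
Set Implicit Arguments.
Unset Strict Implicit.
Unset Printing Implicit Defensive.
Import Order.TTheory GRing.Theory Num.Theory.
Import numFieldNormedType.Exports.
Local Open Scope classical_set_scope.
Local Open Scope ring_scope.

(* The library provides [LspaceType1 mu] (classes of integrable functions modulo
   a.e. equality) as a bare type. It is turned here into a Banach space:
   pointwise operations on representatives, norm ['N[mu]_1[_]] (the integral of
   the absolute value, see [norm_Lspace1E]), and completeness. *)
Section Lspace1_normed.
Context d (T : measurableType d) (R : realType).
Variable mu : {measure set T -> \bar R}.
Local Notation Lfun1 := (LfunType mu (@lexx _ _ 1%E)).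
Local Notation L1 := (LspaceType1 mu).
Local Notation mfunR := {mfun T >-> measurableTypeR R}.
Local Notation aemfun := {mfun_ mu, T >-> measurableTypeR R}.
Local Open Scope quotient_scope.

HB.instance Definition _ := gen_eqMixin L1.
HB.instance Definition _ := gen_choiceMixin L1.

Lemma Lspace1_inj (u v : L1) : u = v :> aemfun -> u = v.
Proof.
case: u => u [[uP]]; case: v => v [[vP]] /= uv.
by move: uP vP; rewrite uv => uP vP; rewrite (Prop_irrelevance uP vP).
Qed.

Definition mfun_of_Lfun1 (f : Lfun1) : mfunR :=
  HB.pack (f : T -> measurableTypeR R)
    (@isMeasurableFun.Build _ _ T (measurableTypeR R) f
       (@measurable_funPT _ _ _ _ f)).

Lemma repr_pi_ae (f : mfunR) : (\pi_aemfun f : aemfun) = f %[ae mu].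
Proof.
have : repr (\pi_aemfun f) = f %[mod aemfun] by rewrite reprK.
by move=> /eqP; rewrite eqmodE => /asboolP.
Qed.

Lemma Lnorm1_ae (f g : T -> R) : measurable_fun setT f ->
  measurable_fun setT g -> f = g %[ae mu] ->
  ('N[mu]_1[EFin \o f] = 'N[mu]_1[EFin \o g])%E.
Proof.
move=> mf mg fg; rewrite !Lnorm1; apply: ge0_ae_eq_integral => //.
- by apply: measurableT_comp => //; exact/measurable_EFinP.
- by apply: measurableT_comp => //; exact/measurable_EFinP.
- by apply: filterS fg => x /= + xT => /(_ xT) ->.
Qed.

Lemma class_Lfun1_subproof (f : Lfun1) :
  finite_norm mu 1 (\pi_aemfun (mfun_of_Lfun1 f) : aemfun).
Proof.
rewrite /finite_norm -(@Lnorm1_ae f); first exact: Lfunction_finite.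
- exact: (@measurable_funPT _ _ _ _ f).
- exact: (@measurable_funPT _ _ _ _ (repr (\pi_aemfun (mfun_of_Lfun1 f) : aemfun))).
- by apply: ae_eq_sym; exact: repr_pi_ae.
Qed.

Definition class_Lfun1 (f : Lfun1) : L1 :=
  HB.pack (\pi_aemfun (mfun_of_Lfun1 f) : aemfun)
    (@isFinLebesgue.Build d T R mu 1%E (lexx 1%E) _ (class_Lfun1_subproof f)).

Lemma repr_Lspace1_subproof (u : L1) : (u : T -> R) \in Lfun mu 1%E.
Proof.
apply/andP; split; rewrite inE /=; last exact: Lebesgue_finite.
exact: (@measurable_funPT _ _ _ _ (repr (u : aemfun))).
Qed.

Definition repr_Lspace1 (u : L1) : Lfun1 := Lfun_Sub (lexx 1%E) (repr_Lspace1_subproof u).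

Lemma repr_class_Lfun1 (f : Lfun1) :
  (repr_Lspace1 (class_Lfun1 f) : T -> R) = f %[ae mu].
Proof. exact: repr_pi_ae. Qed.

Lemma class_Lfun1_eqP (f g : Lfun1) :
  class_Lfun1 f = class_Lfun1 g <-> (f : T -> R) = g %[ae mu].
Proof.
split=> [fg|fg].
  apply: ae_eq_trans (ae_eq_sym (repr_class_Lfun1 f)) _.
  by rewrite fg; exact: repr_class_Lfun1.
by apply: Lspace1_inj; apply/eqP; rewrite /= eqmodE; exact/asboolP.
Qed.

Lemma repr_Lspace1K : cancel repr_Lspace1 class_Lfun1.
Proof.
move=> u; apply: Lspace1_inj; rewrite /= -[RHS]reprK.
by apply/eqP; rewrite eqmodE; apply/asboolP; exact: ae_eq_refl.
Qed.

Lemma Lfun1DE (f g : Lfun1) x : (f + g) x = f x + g x. Proof. by []. Qed.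
Lemma Lfun1NE (f : Lfun1) x : (- f) x = - f x. Proof. by []. Qed.
Lemma Lfun1ZE a (f : Lfun1) x : (a *: f) x = a * f x. Proof. by []. Qed.

Definition zero_Lspace1 : L1 := class_Lfun1 0.
Definition add_Lspace1 (u v : L1) : L1 :=
  class_Lfun1 (repr_Lspace1 u + repr_Lspace1 v).
Definition opp_Lspace1 (u : L1) : L1 := class_Lfun1 (- repr_Lspace1 u).
Definition scale_Lspace1 (a : R) (u : L1) : L1 :=
  class_Lfun1 (a *: repr_Lspace1 u).

Lemma class_Lfun1D f g :
  class_Lfun1 (f + g) = add_Lspace1 (class_Lfun1 f) (class_Lfun1 g).
Proof.
apply/class_Lfun1_eqP.
apply: filterS2 (repr_class_Lfun1 f) (repr_class_Lfun1 g) => x fx gx xT.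
by rewrite !Lfun1DE fx// gx.
Qed.

Lemma class_Lfun1N f : class_Lfun1 (- f) = opp_Lspace1 (class_Lfun1 f).
Proof.
apply/class_Lfun1_eqP; apply: filterS (repr_class_Lfun1 f) => x fx xT.
by rewrite !Lfun1NE fx.
Qed.

Lemma class_Lfun1Z a f :
  class_Lfun1 (a *: f) = scale_Lspace1 a (class_Lfun1 f).
Proof.
apply/class_Lfun1_eqP; apply: filterS (repr_class_Lfun1 f) => x fx xT.
by rewrite !Lfun1ZE fx.
Qed.

Let classE := (class_Lfun1D, class_Lfun1N, class_Lfun1Z).

Lemma add_Lspace1A : associative add_Lspace1.
Proof.
move=> u v w.
rewrite -(repr_Lspace1K u) -(repr_Lspace1K v) -(repr_Lspace1K w).
by rewrite -!classE addrA.
Qed.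

Lemma add_Lspace1C : commutative add_Lspace1.
Proof. by move=> u v; rewrite /add_Lspace1 addrC. Qed.

Lemma add_Lspace10 : left_id zero_Lspace1 add_Lspace1.
Proof. by move=> u; rewrite -(repr_Lspace1K u) -!classE add0r. Qed.

Lemma add_Lspace1N : left_inverse zero_Lspace1 opp_Lspace1 add_Lspace1.
Proof. by move=> u; rewrite -(repr_Lspace1K u) -!classE addNr. Qed.

HB.instance Definition _ := GRing.isZmodule.Build L1
  add_Lspace1A add_Lspace1C add_Lspace10 add_Lspace1N.

Lemma scale_Lspace1A a b u :
  scale_Lspace1 a (scale_Lspace1 b u) = scale_Lspace1 (a * b) u.
Proof. by rewrite -(repr_Lspace1K u) -!classE scalerA. Qed.

Lemma scale_Lspace11 : left_id 1 scale_Lspace1.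
Proof. by move=> u; rewrite -(repr_Lspace1K u) -!classE scale1r. Qed.

Lemma scale_Lspace1Dr : right_distributive scale_Lspace1 +%R.
Proof.
move=> a u v; rewrite -(repr_Lspace1K u) -(repr_Lspace1K v).
rewrite -[LHS]/(scale_Lspace1 a (add_Lspace1 _ _)) -class_Lfun1D -class_Lfun1Z.
by rewrite scalerDr class_Lfun1D !class_Lfun1Z.
Qed.

Lemma scale_Lspace1Dl u : {morph scale_Lspace1^~ u : a b / a + b}.
Proof.
move=> a b; rewrite -(repr_Lspace1K u) -class_Lfun1Z.
by rewrite scalerDl class_Lfun1D !class_Lfun1Z.
Qed.

HB.instance Definition _ := GRing.Zmodule_isLmodule.Build R L1
  scale_Lspace1A scale_Lspace11 scale_Lspace1Dr scale_Lspace1Dl.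

Lemma class_Lfun1_is_linear : linear class_Lfun1.
Proof. by move=> a f g; rewrite class_Lfun1D class_Lfun1Z. Qed.
HB.instance Definition _ :=
  GRing.isLinear.Build R Lfun1 L1 _ class_Lfun1 class_Lfun1_is_linear.

Definition norm_Lspace1 (u : L1) : R := fine ('N[mu]_1[EFin \o (u : T -> R)])%E.

Lemma norm_class_Lfun1 f :
  norm_Lspace1 (class_Lfun1 f) = fine ('N[mu]_1[EFin \o f])%E.
Proof.
congr fine; apply: Lnorm1_ae; last exact: repr_pi_ae.
  exact: (@measurable_funPT _ _ _ _ (repr_Lspace1 (class_Lfun1 f))).
exact: (@measurable_funPT _ _ _ _ f).
Qed.

Lemma norm_Lspace1D u v :
  norm_Lspace1 (u + v) <= norm_Lspace1 u + norm_Lspace1 v.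
Proof.
rewrite -(repr_Lspace1K u) -(repr_Lspace1K v) -raddfD !norm_class_Lfun1.
exact: ler_LnormD.
Qed.

Lemma norm_Lspace1Z a u : norm_Lspace1 (a *: u) = `|a| * norm_Lspace1 u.
Proof.
by rewrite -(repr_Lspace1K u) -linearZ !norm_class_Lfun1 LnormZ -finite_norm_fine -EFinM.
Qed.

Lemma norm_Lspace1_eq0 u : norm_Lspace1 u = 0 -> u = 0.
Proof.
rewrite -(repr_Lspace1K u) norm_class_Lfun1 => /fine_Lnormr_eq0 u0.
by apply/class_Lfun1_eqP.
Qed.

HB.instance Definition _ := @Lmodule_isNormed.Build R L1
  norm_Lspace1 norm_Lspace1D norm_Lspace1Z norm_Lspace1_eq0.

Lemma norm_Lspace1E (u : L1) : (`|u|%R%:E = \int[mu]_x `|(u x)%:E|)%E.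
Proof.
rewrite -[LHS]/((norm_Lspace1 u)%:E) -Lnorm1 fineK//.
by rewrite fin_numElt (lt_le_trans ltNy0) ?Lnorm_ge0//=; exact: Lebesgue_finite.
Qed.

End Lspace1_normed.

Lemma fast_cauchy_complete (R : realType) (V : normedModType R) :
  (forall x : V^nat, (forall n, `|x n.+1 - x n| <= 2^-1 ^+ n) ->
    exists l : V, x @ \oo --> l) ->
  forall F : set_system V, ProperFilter F -> cauchy F -> cvg F.
Proof.
move=> Vc F FF /cauchyP Fc.
pose e n : R := 2^-1 ^+ n.+1.
have e0 n : 0 < e n by rewrite exprn_gt0.
have /choice[x Fx] n : exists x, F (ball x (e n)) by exact: Fc.
have [|l xl] := Vc x.
  move=> n; have [y] := filter_ex (filterI (Fx n) (Fx n.+1)).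
  rewrite -!ball_normE /ball_ /= => -[xy x'y].
  rewrite -(subrK y (x n.+1)) -addrA (le_trans (ler_normD _ _))//.
  rewrite (le_trans (lerD (ltW x'y) (_ : _ <= e n)))//; first by rewrite distrC ltW.
  rewrite /e !exprS mulrA -mulrDl ler_piMl ?exprn_ge0//; lra.
apply/cvg_ex; exists l; apply/fcvgrPdist_lt => eps eps0.
have eps20 : 0 < eps / 2 by rewrite divr_gt0.
have ecvg : e @ \oo --> 0.
  rewrite (_ : e = geometric 2^-1 2^-1).
    by apply: cvg_geometric; rewrite ger0_norm// invf_lt1// ltr1n.
  by apply/funext => n; rewrite /e exprS.
have [n [xln en]] : exists n, `|l - x n| < eps / 2 /\ e n < eps / 2.
  near \oo => n; exists n; split.
    by near: n; exact: cvgr_dist_lt xl _ eps20.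
  rewrite -(ger0_norm (ltW (e0 n))).
  by near: n; exact: cvgr0_norm_lt ecvg _ eps20.
apply: filterS (Fx n) => y; rewrite -ball_normE /ball_ /= => xy.
rewrite -(subrK (x n) l) -addrA (le_lt_trans (ler_normD _ _))//.
by rewrite (splitr eps) ltrD// (lt_trans xy).
Unshelve. all: by end_near. Qed.

Section Lspace1_complete.
Context d (T : measurableType d) (R : realType).
Variable mu : {measure set T -> \bar R}.
Local Notation L1 := (LspaceType1 mu).

Lemma measurable_Lspace1 (u : L1) : measurable_fun setT (u : T -> R).
Proof. exact: (@measurable_funPT _ _ _ _ (repr_Lspace1 u)). Qed.

Lemma integrable_Lspace1 (u : L1) :
  mu.-integrable setT (EFin \o (u : T -> R)).
Proof.  by apply/Lfun1_integrable; exact: repr_Lspace1_subproof. Qed.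

Lemma norm_Lspace1BE (u v : L1) :
  (`|u - v|%R%:E = \int[mu]_x `|(u x - v x)%:E|)%E.
Proof.
have -> : u - v = class_Lfun1 (repr_Lspace1 u - repr_Lspace1 v).
  by rewrite linearB /= !repr_Lspace1K.
rewrite -[X in X%:E]/(norm_Lspace1 _) norm_class_Lfun1.
by rewrite finite_norm_fine Lnorm1.
Qed.

Lemma class_integrable (f : T -> R) : mu.-integrable setT (EFin \o f) ->
  exists u : L1, (u : T -> R) = f %[ae mu].
Proof.
move=> /Lfun1_integrable Lf; exists (class_Lfun1 (Lfun_Sub (lexx 1%E) Lf)).
exact: repr_class_Lfun1.
Qed.

Lemma Lspace1_fast_cauchy (u : L1^nat) :
  (forall n, `|u n.+1 - u n| <= 2^-1 ^+ n) -> exists l : L1, u @ \oo --> l.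
Proof.
move=> u_fast.
pose h n x : \bar R := `|(u n.+1 x - u n x)%:E|%E.
have mh n : measurable_fun setT (h n).
  apply: measurableT_comp => //; apply/measurable_EFinP.
  by apply: measurable_funB; exact: measurable_Lspace1.
pose g x : \bar R := (`|(u 0%N x)%:E| + \sum_(k <oo) h k x)%E.
have h0 n x : (0 <= h n x)%E by exact: abse_ge0.
have mS : measurable_fun setT (fun x => \sum_(k <oo) h k x)%E.
  exact: (@ge0_emeasurable_sum _ _ _ _ h xpredT).
have intS : (\int[mu]_x (\sum_(k <oo) h k x) <= 2%:E)%E.
  rewrite integral_nneseries//.
  apply: (@le_trans _ _ (\sum_(k <oo) (geometric 1 2^-1 k)%:E)%E).
    apply: lee_nneseries => [n _ _|n _]; first exact: integral_ge0.
    by rewrite -norm_Lspace1BE lee_fin /= mul1r.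
  apply: lime_le; first by apply: is_cvg_nneseries => n _ _; rewrite lee_fin geometric_ge0.
  apply: nearW => n; rewrite sumEFin lee_fin.
  have := @geometric_le_lim R n 1 2^-1.
  rewrite mul1r (_ : (1 - 2^-1)^-1 = 2 :> R); last by field.
  by apply; rewrite ?ger0_norm ?invf_lt1 ?ltr1n.
have ig : mu.-integrable setT g.
  apply: integrableD => //.
    by apply: integrable_abse; exact: integrable_Lspace1.
  apply/integrableP; split => //.
  rewrite (le_lt_trans _ (ltry 2))//.
  under eq_integral do rewrite gee0_abs ?nneseries_ge0//.
  exact: intS.
pose f x : \bar R := limn_esup (fun n => (u n x)%:E).
have mf : measurable_fun setT f.
  apply: measurable_fun_limn_esup => n; apply/measurable_EFinP.
  exact: measurable_Lspace1.
have u_cvg : {ae mu, forall x, [set: T] x -> (fun n => (u n x)%:E) @ \oo --> f x}.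
  apply: filterS (integrable_ae measurableT ig) => x /(_ I) gx _.
  have Sx : (\sum_(k <oo) h k x < +oo)%E.
    move: gx; rewrite /g ge0_fin_numE ?adde_ge0 ?nneseries_ge0//.
    by apply: le_lt_trans; rewrite leeDr.
  have c : cvgn (fun n => u n x).
    have /normed_cvg : cvgn [normed series (telescope (fun n => u n x))].
      by apply: nnseries_is_cvg => // i; exact: normr_ge0.
    rewrite telescopeK => /= c.
    rewrite (_ : (fun n => u n x) = (fun n => (u n x - u 0%N x) + u 0%N x)).
      by apply: is_cvgD => //; exact: is_cvg_cst.
    by apply/funext => n; rewrite subrK.
  have c' : cvgn (fun n => (u n x)%:E).
    by apply/cvg_ex; exists (limn (fun n => u n x))%:E; apply: cvg_EFin => //; exact: nearW.
  by rewrite /f is_cvg_limn_esupE.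
have u_g : {ae mu, forall x n, [set: T] x -> (`|(u n x)%:E| <= g x)%E}.
  apply: nearW => x n _.
  rewrite (eq_sum_telescope (fun n => u n x) n) EFinD (le_trans (lee_abs_add _ _))//.
  rewrite leeD2l// seriesEnat /=.
  rewrite (@le_trans _ _ (\sum_(0 <= k < n) h k x)%E)//.
    by rewrite sumEFin lee_fin ler_norm_sum.
  by apply: (@nneseries_lim_ge _ (fun k => h k x)) => k _ _; exact: h0.
have mu_ n : measurable_fun setT (fun x => (u n x)%:E).
  by apply/measurable_EFinP; exact: measurable_Lspace1.
have [fi ul _] := dominated_convergence measurableT mu_ mf u_cvg ig u_g.
have [|l lf] := @class_integrable (fine \o f).
  apply: le_integrable fi => //.
    by apply/measurable_EFinP; exact: measurableT_comp.
  by move=> x _ /=; case: (f x) => //= [|]; rewrite ?normr0 ?leey.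
have {}lf : {ae mu, forall x, (l x)%:E = f x}.
  apply: filterS2 lf (integrable_ae measurableT fi) => x /(_ I) -> /(_ I).
  exact: fineK.
exists l; apply/cvgrPdist_lt => eps eps0.
have norm_uf n : (`|u n - l|%R%:E = \int[mu]_x `|(u n x)%:E - f x|)%E.
  rewrite norm_Lspace1BE; apply: ge0_ae_eq_integral => //.
  - apply: measurableT_comp => //; apply/measurable_EFinP.
    by apply: measurable_funB; exact: measurable_Lspace1.
  - by apply: measurableT_comp => //; exact: emeasurable_funB.
  - by apply: filterS lf => x lfx _; rewrite EFinB lfx.
have {}ul : (fun n => `|u n - l| : R) @ \oo --> (0 : R).
  have -> : (fun n => `|u n - l| : R) =
      fine \o (fun n => \int[mu]_x `|(u n x)%:E - f x|)%E.
    by apply/funext => n; rewrite /= -norm_uf.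
  exact: fine_cvg ul.
near=> n; rewrite distrC (le_lt_trans (ler_norm _))//.
by near: n; exact: cvgr0_norm_lt ul _ eps0.
Unshelve. all: by end_near.
Qed.

End Lspace1_complete.

HB.instance Definition _ d (T : measurableType d) (R : realType)
    (mu : {measure set T -> \bar R}) :=
  Uniform_isComplete.Build (LspaceType1 mu)
    (fast_cauchy_complete (@Lspace1_fast_cauchy d T R mu)).

Lemma fast_cauchy_cvg (R : realType) (V : completeNormedModType R) (x : V^nat) :
  (forall n, `|x n.+1 - x n| <= 2^-1 ^+ n) -> cvgn x.
Proof.
move=> xf; suff : cvgn (series (telescope x)).
  rewrite telescopeK => c.
  rewrite (_ : x = (fun n => (x n - x 0%N) + x 0%N)).
    by apply: is_cvgD => //; exact: is_cvg_cst.
  by apply/funext => n; rewrite subrK.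
apply: normed_cvg; apply: (@series_le_cvg _ _ (geometric 1 2^-1)).
- by move=> n; exact: normr_ge0.
- by move=> n; apply: geometric_ge0.
- by move=> n; rewrite /geometric /= mul1r; exact: xf.
- by apply: is_cvg_geometric_series; rewrite ger0_norm// invf_lt1// ltr1n.
Qed.

(* The product with the sum of the norms: the instances on [U * V] itself carry
   the max-norm. *)
Definition l1sum (U V : Type) : Type := (U * V)%type.

Section l1sum_normed.
Context (R : realType) (U V : normedModType R).

HB.instance Definition _ := GRing.Lmodule.copy (l1sum U V) (U * V)%type.

Definition l1sum_norm (x : l1sum U V) : R := `|x.1| + `|x.2|.

Lemma l1sum_normD x y : l1sum_norm (x + y) <= l1sum_norm x + l1sum_norm y.
Proof. by rewrite /l1sum_norm addrACA lerD// ler_normD. Qed.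

Lemma l1sum_normZ a x : l1sum_norm (a *: x) = `|a| * l1sum_norm x.
Proof. by rewrite /l1sum_norm !normrZ mulrDr. Qed.

Lemma l1sum_norm_eq0 x : l1sum_norm x = 0 -> x = 0.
Proof.
case: x => u v /eqP; rewrite /l1sum_norm paddr_eq0//= !normr_eq0.
by move=> /andP[/eqP -> /eqP ->].
Qed.

HB.instance Definition _ := @Lmodule_isNormed.Build R (l1sum U V)
  l1sum_norm l1sum_normD l1sum_normZ l1sum_norm_eq0.

Lemma l1sum_normE (x : l1sum U V) : `|x| = `|x.1| + `|x.2|.
Proof. by []. Qed.

End l1sum_normed.

Lemma l1sum_fast_cauchy (R : realType) (U V : completeNormedModType R)
    (x : (l1sum U V)^nat) :
  (forall n, `|x n.+1 - x n| <= 2^-1 ^+ n) -> exists l : l1sum U V, x @ \oo --> l.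
Proof.
move=> xf; have x1 : cvgn (fun n => (x n).1).
  apply: fast_cauchy_cvg => n; apply: le_trans (xf n).
  by rewrite l1sum_normE /= lerDl.
have x2 : cvgn (fun n => (x n).2).
  apply: fast_cauchy_cvg => n; apply: le_trans (xf n).
  by rewrite l1sum_normE /= lerDr.
exists (limn (fun n => (x n).1), limn (fun n => (x n).2)).
apply/cvgrPdist_lt => e e0; near=> n.
rewrite l1sum_normE /= (splitr e) ltrD//.
  by near: n; apply: cvgr_dist_lt; rewrite ?divr_gt0.
by near: n; apply: cvgr_dist_lt; rewrite ?divr_gt0.
Unshelve. all: by end_near. Qed.


HB.instance Definition _ (R : realType) (U V : completeNormedModType R) :=
  Uniform_isComplete.Build (l1sum U V)
    (fast_cauchy_complete (@l1sum_fast_cauchy R U V)).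

Record closed_subspace (R : realType) (X : normedModType R) := ClosedSubspace {
  closed_subspace_pred :> {pred X} ;
  closed_subspace_submod : submod_closed closed_subspace_pred ;
  closed_subspace_closed : closed [set` closed_subspace_pred] }.
Arguments closed_subspace_closed {R X} Y : rename.

HB.instance Definition _ (R : realType) (X : normedModType R)
    (Y : closed_subspace X) :=
  GRing.isSubmodClosed.Build R X (closed_subspace_pred Y)
    (closed_subspace_submod Y).

Section subspace_normed.
Context (R : realType) (X : normedModType R) (Y : closed_subspace X).

Definition subspace_type : Type := {x : X | x \in closed_subspace_pred Y}.

HB.instance Definition _ := SubChoice.on subspace_type.
HB.instance Definition _ := [SubChoice_isSubLmodule of subspace_type by <:].

Definition subspace_norm (y : subspace_type) : R := `|val y|.

Lemma subspace_normD x y :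
  subspace_norm (x + y) <= subspace_norm x + subspace_norm y.
Proof. exact: ler_normD. Qed.

Lemma subspace_normZ a x : subspace_norm (a *: x) = `|a| * subspace_norm x.
Proof. exact: normrZ. Qed.

Lemma subspace_norm_eq0 x : subspace_norm x = 0 -> x = 0.
Proof. by move=> /normr0_eq0 x0; exact: val_inj. Qed.

HB.instance Definition _ := @Lmodule_isNormed.Build R subspace_type
  subspace_norm subspace_normD subspace_normZ subspace_norm_eq0.

End subspace_normed.

Lemma subspace_fast_cauchy (R : realType) (X : completeNormedModType R)
    (Y : closed_subspace X) (x : (subspace_type Y)^nat) :
  (forall n, `|x n.+1 - x n| <= 2^-1 ^+ n) ->
  exists l : subspace_type Y, x @ \oo --> l.
Proof.
move=> xf; have xc : cvgn (fun n => val (x n)) by exact: fast_cauchy_cvg.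
have lY : limn (fun n => val (x n)) \in closed_subspace_pred Y.
  suff : [set` closed_subspace_pred Y] (limn (fun n => val (x n))) by [].
  apply: (@closed_cvg _ _ \oo _ (fun n => val (x n)) [set` closed_subspace_pred Y] (closed_subspace_closed Y) _ _ xc).
  by apply: nearW => n; exact: valP.
exists (Sub (limn (fun n => val (x n))) lY : subspace_type Y).
apply/cvgrPdist_lt => e e0; near=> n.
rewrite -[ltLHS]/(`|limn (fun n => val (x n)) - val (x n)|).
by near: n; exact: cvgr_dist_lt.
Unshelve. all: by end_near. Qed.


HB.instance Definition _ (R : realType) (X : completeNormedModType R)
    (Y : closed_subspace X) :=
  Uniform_isComplete.Build (subspace_type Y)
    (fast_cauchy_complete (@subspace_fast_cauchy R X Y)).

Section quotient_normed.
Context (R : realType) (X : normedModType R) (Y : closed_subspace X).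
Local Open Scope quotient_scope.

Definition quotient_space : Type := Quotient.quot (closed_subspace_pred Y).
HB.instance Definition _ := GRing.Zmodule.on quotient_space.
HB.instance Definition _ := EqQuotient.on quotient_space.


Lemma quotient_piB x y : (\pi_quotient_space (x - y) : quotient_space) = \pi x - \pi y.
Proof. exact: raddfB. Qed.

Definition quotient_scale (a : R) (q : quotient_space) : quotient_space :=
  \pi_quotient_space (a *: repr q).

Lemma quotient_piZ a x :
  \pi_quotient_space (a *: x) = quotient_scale a (\pi x).
Proof.
apply/eqP; rewrite -Quotient.idealrBE -scalerBr rpredZ//.
by rewrite Quotient.idealrBE reprK.
Qed.

Let quotient_piD x y : (\pi_quotient_space (x + y) : quotient_space) = \pi x + \pi y.
Proof. exact: raddfD. Qed.

Lemma quotient_scaleA a b q :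
  quotient_scale a (quotient_scale b q) = quotient_scale (a * b) q.
Proof. by elim/quotW: q => x; rewrite -(quotient_piZ b) -!quotient_piZ scalerA. Qed.

Lemma quotient_scale1 : left_id 1 quotient_scale.
Proof. by elim/quotW => x; rewrite -quotient_piZ scale1r. Qed.

Lemma quotient_scaleDr : right_distributive quotient_scale +%R.
Proof.
move=> a; elim/quotW => x; elim/quotW => y; rewrite -quotient_piD -!quotient_piZ.
by rewrite scalerDr quotient_piD.
Qed.

Lemma quotient_scaleDl q : {morph quotient_scale^~ q : a b / a + b}.
Proof.
by move=> a b; elim/quotW: q => x; rewrite -!quotient_piZ scalerDl quotient_piD.
Qed.

HB.instance Definition _ := GRing.Zmodule_isLmodule.Build R quotient_space
  quotient_scaleA quotient_scale1 quotient_scaleDr quotient_scaleDl.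

Definition quotient_map (x : X) : quotient_space := \pi_quotient_space x.

Lemma quotient_map_linear : linear quotient_map.
Proof. by move=> a x y; rewrite /quotient_map quotient_piD quotient_piZ. Qed.

HB.instance Definition _ :=
  GRing.isLinear.Build R X quotient_space _ quotient_map quotient_map_linear.

Lemma quotient_map_surj q : exists x, quotient_map x = q.
Proof. by exists (repr q); exact: reprK. Qed.

Lemma quotient_map_eq0 x : (quotient_map x == 0) = (x \in closed_subspace_pred Y).
Proof. by rewrite -[x in RHS]subr0 Quotient.idealrBE -[0 in LHS](raddf0 quotient_map). Qed.

(* The distance from the coset [q] to the origin. *)
Definition quotient_norm (q : quotient_space) : R :=
  inf [set `|x| | x in [set x | quotient_map x = q]].

Lemma quotient_norm_has_inf q :
  has_inf [set `|x| | x in [set x | quotient_map x = q]].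
Proof.
split; first by have [x xq] := quotient_map_surj q; exists `|x|, x.
by exists 0 => _ [x _ <-].
Qed.

Lemma quotient_norm_le x : quotient_norm (quotient_map x) <= `|x|.
Proof. by apply: inf_lbound; [exact: (quotient_norm_has_inf _).2|exists x]. Qed.

Lemma quotient_norm_ge0 q : 0 <= quotient_norm q.
Proof.
by apply: lb_le_inf; [exact: (quotient_norm_has_inf _).1|move=> _ [x _ <-]].
Qed.

Lemma quotient_norm_lt q (e : R) : 0 < e ->
  exists2 x, quotient_map x = q & `|x| < quotient_norm q + e.
Proof.
move=> e0; have [_ [x xq <-] xe] := inf_adherent e0 (quotient_norm_has_inf q).
by exists x.
Qed.

Lemma quotient_normD q r :
  quotient_norm (q + r) <= quotient_norm q + quotient_norm r.
Proof.
apply/ler_addgt0Pr => e e0; have e20 : 0 < e / 2 by rewrite divr_gt0.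
have [x <- /ltW xe] := quotient_norm_lt q e20.
have [y <- /ltW ye] := quotient_norm_lt r e20.
rewrite -raddfD (le_trans (quotient_norm_le _))// (le_trans (ler_normD _ _))//.
by rewrite (splitr e) addrACA lerD.
Qed.

Let quotient_normZ_le a q : quotient_norm (a *: q) <= `|a| * quotient_norm q.
Proof.
apply/ler_addgt0Pr => e e0.
have a10 : 0 < `|a| + 1 by rewrite ltr_wpDl.
have [x <- /ltW xe] := quotient_norm_lt q (divr_gt0 e0 a10).
rewrite -linearZ (le_trans (quotient_norm_le _))// normrZ.
rewrite (le_trans (ler_wpM2l _ xe))// mulrDr lerD2l.
rewrite mulrCA ler_piMr//; first exact: ltW.
by rewrite ler_pdivrMr// mul1r lerDl.
Qed.

Lemma quotient_normZ a q : quotient_norm (a *: q) = `|a| * quotient_norm q.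
Proof.
apply/eqP; rewrite eq_le quotient_normZ_le /=.
have [->|a0] := eqVneq a 0; first by rewrite normr0 mul0r quotient_norm_ge0.
rewrite -ler_pdivlMl ?normr_gt0// -normfV.
by rewrite (le_trans _ (quotient_normZ_le _ _))// scalerA mulVf// scale1r.
Qed.

Lemma quotient_norm_eq0 q : quotient_norm q = 0 -> q = 0.
Proof.
move=> q0; have [y yq] := quotient_map_surj q.
apply/eqP; rewrite -yq quotient_map_eq0.
suff : closure [set` closed_subspace_pred Y] y.
  by move=> /(closed_subspace_closed Y).
move=> A /nbhs_ballP[e /= e0 yA].
have [x xq] := quotient_norm_lt q e0; rewrite q0 add0r => xe.
exists (y - x); split.
  by rewrite /= -quotient_map_eq0 raddfB /= yq xq subrr.
by apply: yA; rewrite -ball_normE /ball_ /= opprB addrC subrK.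
Qed.

HB.instance Definition _ := @Lmodule_isNormed.Build R quotient_space
  quotient_norm quotient_normD quotient_normZ quotient_norm_eq0.

Lemma quotient_map_continuous : continuous quotient_map.
Proof.
move=> x; apply/cvgrPdist_lt => e e0.
have xy : \forall y \near x, `|x - y| < e by exact: cvgr_dist_lt.
apply: filterS xy => y; apply: le_lt_trans.
by rewrite -raddfB; exact: quotient_norm_le.
Qed.

End quotient_normed.

Lemma quotient_fast_cauchy (R : realType) (X : completeNormedModType R)
    (Y : closed_subspace X) (q : (quotient_space Y)^nat) :
  (forall n, `|q n.+1 - q n| <= 2^-1 ^+ n) ->
  exists l : quotient_space Y, q @ \oo --> l.
Proof.
move=> qf.
have /choice[d dP] n : exists x : X,
    quotient_map Y x = q n.+1 - q n /\ `|x| <= 2 * 2^-1 ^+ n.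
  have e0 : 0 < 2^-1 ^+ n :> R by rewrite exprn_gt0.
  have [x xq xn] := quotient_norm_lt (q n.+1 - q n) e0.
  exists x; split => //; rewrite (le_trans (ltW xn))// mulr_natl mulr2n lerD2r.
  exact: qf.
have [x0 x0q] := quotient_map_surj (q 0%N).
have dc : cvgn (series d).
  apply: normed_cvg; apply: (@series_le_cvg _ _ (geometric 2 2^-1)).
  - by move=> n; exact: normr_ge0.
  - by move=> n; apply: geometric_ge0.
  - by move=> n; exact: (dP n).2.
  - by apply: is_cvg_geometric_series; rewrite ger0_norm// invf_lt1// ltr1n.
have qE n : q n = quotient_map Y (x0 + series d n).
  rewrite raddfD /= x0q seriesEnat /= raddf_sum /=.
  under eq_bigr do rewrite (dP _).1.
  by rewrite telescope_sumr// addrC subrK.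
exists (quotient_map Y (x0 + limn (series d))).
have -> : q = quotient_map Y \o (fun n => x0 + series d n) by apply/funext.
apply: continuous_cvg; first exact: quotient_map_continuous.
by apply: cvgD => //; exact: cvg_cst.
Qed.

HB.instance Definition _ (R : realType) (X : completeNormedModType R)
    (Y : closed_subspace X) :=
  Uniform_isComplete.Build (quotient_space Y)
    (fast_cauchy_complete (@quotient_fast_cauchy R X Y)).

Section operators.
Context (R : realType).
Implicit Types X Y Z : completeNormedModType R.

(* Only meaningful for bounded [T]: [sup] is 0 on an unbounded set. *)
Definition opnorm X Y (T : X -> Y) : R :=
  sup [set `|T x| | x in [set x | `|x| <= 1]].

Definition rank_one X Y (T : X -> Y) : Prop :=
  exists2 y : Y, y != 0 & range T = [set a *: y | a in [set: R]].

(* For linear maps between normed spaces, [continuous] is the same as bounded. *)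
Definition daugavet_property X : Prop :=
  forall T : {linear X -> X}, continuous T -> rank_one T ->
    opnorm (fun x => x + T x) = 1 + opnorm T.

Definition strong_daugavet X Y (T : {linear X -> Y}) : Prop :=
  forall (x y : X) (e : R), `|x| = 1 -> `|y| = 1 -> 0 < e ->
    exists z : X, [/\ `|z| = 1, `|T (z - y)| < e & `|z + x| > 2 - e].

Section tilde_plus.
Context X Y1 Y2 (T1 : {linear X -> Y1}) (T2 : {linear X -> Y2}).

Definition tilde_plus (x : X) : l1sum Y1 Y2 := (T1 x, T2 x).

Lemma tilde_plus_is_linear : linear tilde_plus.
Proof. by move=> a x y; rewrite /tilde_plus !linearP. Qed.

HB.instance Definition _ :=
  GRing.isLinear.Build R X (l1sum Y1 Y2) _ tilde_plus tilde_plus_is_linear.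

Lemma tilde_plus_continuous :
  continuous T1 -> continuous T2 -> continuous tilde_plus.
Proof.
move=> T1c T2c x; apply/cvgrPdist_lt => e e0.
have e20 : 0 < e / 2 by rewrite divr_gt0.
have h1 : \forall y \near x, `|T1 x - T1 y| < e / 2.
  exact: cvgr_dist_lt (T1c x) _ e20.
have h2 : \forall y \near x, `|T2 x - T2 y| < e / 2.
  exact: cvgr_dist_lt (T2c x) _ e20.
apply: filterS2 h1 h2 => y xy1 xy2.
by rewrite l1sum_normE /= (splitr e) ltrD.
Qed.

End tilde_plus.

Definition narrow X Y (T : {linear X -> Y}) : Prop :=
  forall f : {linear X -> R^o}, continuous f ->
    strong_daugavet (tilde_plus T f).

(* These are notions for spaces [X] with the Daugavet property, such as [L1]. *)
Definition almost_rich X (Y : closed_subspace X) : Prop :=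
  strong_daugavet (quotient_map Y).

Definition rich X (Y : closed_subspace X) : Prop := narrow (quotient_map Y).

End operators.

(* Lebesgue measure on [0, 1], as a measure on the line that vanishes off [0, 1];
   two functions are then a.e. equal iff they are so on [0, 1]. *)
Definition lebesgue01 (R : realType) :
    {measure set (measurableTypeR R) -> \bar R} :=
  mrestr (@lebesgue_measure R) (measurable_itv `[0, 1]).

Definition L1 (R : realType) : completeNormedModType R :=
  LspaceType1 (lebesgue01 R).

(* Main.v *)
From HB Require Import structures.
Require Import Defs.
From mathcomp Require Import all_boot all_order all_algebra.
From mathcomp Require Import all_classical all_reals all_analysis measurable_realfun.
From mathcomp Require Import ring lra.
Set Implicit Arguments.
Unset Strict Implicit.
Unset Printing Implicit Defensive.
Import Order.TTheory GRing.Theory Num.Theory.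
Import numFieldNormedType.Exports.
Import HBSimple.
Local Open Scope classical_set_scope.
Local Open Scope ring_scope.

(** The example is assembled from pairwise disjoint pieces of [L1]. Restricting
    to disjoint sets [A 0, A 1, ...] of positive measure gives orthogonal
    L-projections [Q k], integration gives a contractive functional [f], and the
    normalized indicator [b k] of [A k] satisfies [Q k (b k) = b k] and
    [f (b k) = 1]. As [L1] is separable, the unit ball of the range of [Q 0] has
    a dense sequence [d 0, d 1, ...], in which each term may be repeated
    infinitely often. The operator
    [[
      T u = Q 0 u + \sum_k f (Q k.+1 u) *: d k
    ]]
    (called [gather] below) is a contraction of [L1] onto the range of [Q 0]: it
    fixes that range and sends [b k.+1] to [d k]. The subspace is
    [Y = {u | T u is a multiple of b 0}].

    Almost rich: given [x] and [y] of norm one, [T y] lies in the unit ball of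
    the range of [Q 0], so infinitely many [d k] are close to it, and for one of
    these the piece [Q k.+1 x] is small because the norms of the pieces of [x]
    add up to at most one. Then [z = b k.+1] is almost disjoint from [x], whence
    [`|z + x|] is almost 2, and [z - y - (d k - T y)] is killed by [T], so that
    [z - y] is within [`|d k - T y|] of [Y] ([defect_subspace_almost_rich]).

    No Daugavet property: let [h] be in [Y], say [T h = c b 0], and put
    [phi = f \o Q 0]. If [phi h] is almost [`|h|], then [h] has almost no mass
    outside the zeroth piece, so [Q 0 h] is almost [T h] and [h] is almost
    [phi h *: b 0]. Quantitatively, [`|h - phi h *: b 0| <= 3 (`|h| - `|phi h|)]
    ([defect_subspace_dist_b0]). Together with the trivial bound
    [`|h| + `|phi h|] this gives [3 / 2 < 2] for the norm of the identity of [Y]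
    minus the rank-one projection [phi(.) *: b 0] of norm one. The same estimate
    refutes richness: if [z] is nearly in [Y] and [phi z] is nearly 1, then [z]
    is close to [b 0] and [`|z - b 0|] cannot be almost 2. The quotient map by
    [Y] is then strong Daugavet without being narrow. *)

(** * Bounded linear maps and L-projections *)

Section bounded_linear.
Context (R : realType).

Lemma le_continuous_linear (V W : normedModType R) (T : {linear V -> W}) (C : R) :
  (forall u, `|T u| <= C * `|u|) -> continuous T.
Proof.
move=> TC u; apply/cvgrPdist_lt => e e0.
have C0 : 0 < `|C| + 1 by rewrite ltr_wpDl.
have uv : \forall v \near u, `|u - v| < e / (`|C| + 1).
  by apply: cvgr_dist_lt => //; rewrite divr_gt0.
apply: filterS uv => v; rewrite ltr_pdivlMr// mulrC; apply: le_lt_trans.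
rewrite -raddfB (le_trans (TC _))// ler_wpM2r//.
by rewrite (le_trans (ler_norm _))// lerDl.
Qed.

Definition L_projection (V : normedModType R) (Q : {linear V -> V}) : Prop :=
  (forall u, Q (Q u) = Q u) /\ (forall u, `|u| = `|Q u| + `|u - Q u|).

End bounded_linear.

(** * A subspace that is almost rich but fails the Daugavet property *)

Section almost_rich_not_daugavet.
Context (R : realType) (X : completeNormedModType R).
Context (Q : nat -> {linear X -> X}).
Context (QL : forall k, L_projection (Q k))
  (Qorth : forall j k u, j != k -> Q j (Q k u) = 0).
Context (f : {linear X -> R^o}).
Context (f_le : forall u, `|f u| <= `|u|).
Context (b : nat -> X) (Qb : forall k, Q k (b k) = b k)
  (b1 : forall k, `|b k| = 1) (fb : forall k, f (b k) = 1).
Context (I : countType) (e : I -> X)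
  (e_dense : forall u eps, 0 < eps -> exists i, `|u - e i| < eps).

Lemma Qorth_sub j k u : j != k -> Q j (u - Q k u) = Q j u.
Proof. by move=> jk; rewrite raddfB /= (Qorth _ jk) subr0. Qed.

(** A Bessel inequality: peeling off [Q k u] splits the norm additively and, by
    orthogonality, leaves the other components of [u] unchanged. *)
Lemma sum_norm_L_projection u (s : seq nat) : uniq s -> \sum_(k <- s) `|Q k u| <= `|u|.
Proof.
elim: s u => [|k s IHs] u /=; first by rewrite big_nil.
move=> /andP[ks us]; rewrite big_cons ((QL k).2 u) lerD2l.
apply: le_trans (IHs _ us); rewrite !big_seq ler_sum// => j js.
by rewrite Qorth_sub//; apply: contraNneq ks => <-.
Qed.

Lemma norm_L_projection_le k u : `|Q k u| <= `|u|.
Proof. by rewrite ((QL k).2 u) lerDl. Qed.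

Definition ball_retract (v : X) : X := (Num.max 1 `|v|)^-1 *: v.

Lemma ball_retract_le1 v : `|ball_retract v| <= 1.
Proof.
rewrite normrZ normfV ger0_norm ?le_max ?ler01// mulrC.
by rewrite ler_pdivrMr ?lt_max ?ltr01// mul1r le_max lexx orbT.
Qed.

(** Approximating a vector of the unit ball by a dense sequence yields vectors
    that may stick out of the ball; pulling them back costs a factor 2. *)
Lemma ball_retract_dist (u v : X) : `|u| <= 1 -> `|u - ball_retract v| <= 2 * `|u - v|.
Proof.
move=> u1; rewrite mulr_natl mulr2n.
rewrite -[u - ball_retract v](subrKA v) (le_trans (ler_normD _ _))// lerD2l.
rewrite /ball_retract -{1}[v]scale1r -scalerBl normrZ.
have [v1|v1] := leP `|v| 1; first by rewrite invr1 subrr normr0 mul0r.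
have v0 : `|v| != 0 by rewrite gt_eqF// (lt_trans _ v1).
rewrite -[X in _ * X <= _]ger0_norm// -normrM mulrBl mul1r mulVf//.
rewrite ger0_norm ?subr_ge0; last exact: ltW.
by have := ler_normD (v - u) u; rewrite subrK distrC; lra.
Qed.

(** The index codes a pair of natural number and index of the dense family, so
    that each vector is the target of infinitely many blocks. *)
Definition target k : X :=
  if unpickle k is Some ni then ball_retract (Q 0%N (e (ni : nat * I).2)) else 0.

Lemma target_le1 k : `|target k| <= 1.
Proof.
by rewrite /target; case: unpickle => [?|]; rewrite ?ball_retract_le1// normr0.
Qed.

Lemma Q0_target k : Q 0%N (target k) = target k.
Proof.
rewrite /target; case: unpickle => [?|]; last by rewrite raddf0.
by rewrite /ball_retract linearZ /= (QL _).1.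
Qed.

(** The blocks that share a target near [u] are infinitely many, whereas the
    components of [x] on them have a finite total norm: some of these components
    are small. This is what lets a block be chosen away from [x]. *)
Lemma target_dense u x (eps : R) : Q 0%N u = u -> `|u| <= 1 -> 0 < eps ->
  exists k, `|u - target k| < eps /\ `|Q k.+1 x| < eps.
Proof.
move=> Qu u1 eps0; have eps20 : 0 < eps / 2 by rewrite divr_gt0.
have [i ui] := e_dense u eps20.
have ti (n : nat) : `|u - target (pickle (n, i))| < eps.
  rewrite /target pickleK /= (le_lt_trans (ball_retract_dist _ _))//.
  rewrite -ltr_pdivlMl// mulrC (le_lt_trans _ ui)//.
  by have := norm_L_projection_le 0%N (u - e i); rewrite raddfB /= Qu.
(* If all components on these blocks were at least eps, N of them would exceed
   the norm of x. *)
pose N := (Num.truncn (`|x| / eps)).+1.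
have [[n]|xN] := pselect (exists n : nat, `|Q (pickle (n, i)).+1 x| < eps).
  by exists (pickle (n, i)).
have uN : uniq [seq (pickle (n, i)).+1 | n <- iota 0 N].
  rewrite map_inj_uniq ?iota_uniq// => n m /succn_inj.
  by move=> /(pcan_inj (@pickleK (nat * I)%type)) [].
have := sum_norm_L_projection x uN; rewrite big_map leNgt => /negP[].
rewrite (@lt_le_trans _ _ (\sum_(n <- iota 0 N) eps))//.
  rewrite big_const_seq count_predT size_iota iter_addr addr0 -mulr_natl.
  by rewrite -ltr_pdivrMr// truncnS_gt.
by apply: ler_sum => n _; rewrite leNgt; apply/negP => xn; apply: xN; exists n.
Qed.

Definition transfer_term u k : X := f (Q k.+1 u) *: target k.

Definition transfer u : X := limn (series (transfer_term u)).

Lemma sum_transfer_term u n :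
  \sum_(0 <= k < n) `|transfer_term u k| <= `|u - Q 0%N u|.
Proof.
have us : uniq [seq k.+1 | k <- index_iota 0 n].
  by rewrite map_inj_uniq ?iota_uniq// => ? ? [].
apply: le_trans (sum_norm_L_projection _ us); rewrite big_map.
apply: ler_sum => k _.
rewrite Qorth_sub// normrZ -[leRHS]mulr1.
by rewrite ler_pM// ?target_le1//; exact: f_le.
Qed.

Lemma transfer_cvg u : series (transfer_term u) @ \oo --> transfer u.
Proof.
apply: normed_cvg; apply: nondecreasing_is_cvgn.
  by apply: nondecreasing_series => n _ _ /=.
exists `|u - Q 0%N u| => _ [n _ <-] /=.
by rewrite seriesEnat /=; exact: sum_transfer_term.
Qed.

Lemma transfer_is_linear : linear transfer.
Proof.
move=> c u v; apply/cvg_lim => //.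
rewrite (_ : series _ = (fun n => c *: series (transfer_term u) n +
                                  series (transfer_term v) n)).
  by apply: cvgD; [apply: cvgZr|]; exact: transfer_cvg.
apply/funext => n; rewrite !seriesEnat /= scaler_sumr -big_split /=.
by apply: eq_bigr => k _; rewrite /transfer_term !linearP /= scalerDl scalerA.
Qed.

HB.instance Definition _ := GRing.isLinear.Build R X X _ transfer transfer_is_linear.

(** Transfer moves mass from the blocks [k > 0] and the targets have norm at most
    one, so it only sees the part of [u] outside the range of [Q 0]. *)
Lemma norm_transfer u : `|transfer u| <= `|u - Q 0%N u|.
Proof.
have uc : `|series (transfer_term u) n| @[n --> \oo] --> `|transfer u|.
  by apply: cvg_norm; exact: transfer_cvg.
rewrite -(cvg_lim _ uc)//; apply: limr_le; first exact: cvgP uc.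
apply: nearW => n /=; apply: le_trans (sum_transfer_term u n).
by rewrite seriesEnat; exact: ler_norm_sum.
Qed.

Lemma Q0_transfer u : Q 0%N (transfer u) = transfer u.
Proof.
have Qc : continuous (Q 0%N).
  by apply: (@le_continuous_linear _ _ _ _ 1) => v; rewrite mul1r norm_L_projection_le.
have {Qc} Qc : Q 0%N (series (transfer_term u) n) @[n --> \oo] --> Q 0%N (transfer u).
  by apply: (continuous_cvg _ (Qc _)); exact: transfer_cvg.
rewrite -(cvg_lim _ Qc)//; congr (limn _); apply/funext => n.
rewrite /= seriesEnat /= raddf_sum /=.
by apply: eq_bigr => k _; rewrite /transfer_term linearZ /= Q0_target.
Qed.

Lemma transfer_b k : transfer (b k.+1) = target k.
Proof.
apply/cvg_lim => //; apply: cvg_near_cst; exists k.+1 => // n /= kn.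
rewrite seriesEnat /= big_mkord (bigD1 (Ordinal kn)) //= big1 ?addr0 => [|j jk].
  by rewrite /transfer_term Qb fb scale1r.
by rewrite /transfer_term -Qb Qorth ?raddf0 ?scale0r.
Qed.

(** The contraction onto the range of [Q 0] which is the identity there and maps
    [b k.+1] to [target k]. *)
Definition gather u : X := Q 0%N u + transfer u.

Lemma gather_is_linear : linear gather.
Proof. by move=> c u v; rewrite /gather !linearP /= scalerDr addrACA. Qed.

HB.instance Definition _ :=
  GRing.isLinear.Build R X X _ gather gather_is_linear.

Lemma norm_gather u : `|gather u| <= `|u|.
Proof.
by rewrite ((QL 0).2 u) (le_trans (ler_normD _ _))// lerD2l norm_transfer.
Qed.

Lemma Q0_gather u : Q 0%N (gather u) = gather u.
Proof. by rewrite raddfD /= (QL _).1 Q0_transfer. Qed.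

Lemma gather_b k : gather (b k.+1) = target k.
Proof. by rewrite /gather transfer_b -Qb Qorth// add0r. Qed.

Lemma gather_id u : Q 0%N u = u -> gather u = u.
Proof.
move=> Qu; rewrite /gather Qu; have := norm_transfer u.
by rewrite Qu subrr normr0 normr_le0 => /eqP ->; rewrite addr0.
Qed.

(** As [f (b 0) = 1], this vanishes exactly when [gather u] is a multiple of
    [b 0], and it is linear and continuous in [u]: the subspace is a kernel. *)
Definition defect u : X := gather u - f (gather u) *: b 0%N.

Lemma defect_is_linear : linear defect.
Proof.
move=> c u v; rewrite /defect !linearP /= scalerDl scalerBr scalerA.
by rewrite opprD addrACA.
Qed.

HB.instance Definition _ := GRing.isLinear.Build R X X _ defect defect_is_linear.

Lemma continuous_defect : continuous defect.
Proof.
apply: (@le_continuous_linear _ _ _ _ 2) => u.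
rewrite (le_trans (ler_normB _ _))// normrZ b1 mulr1 mulr_natl mulr2n.
by rewrite lerD ?norm_gather// (le_trans (f_le _))// norm_gather.
Qed.

Definition defect_ker : {pred X} := [pred u | defect u == 0].

Lemma defect_ker_submod : submod_closed defect_ker.
Proof.
split=> [|c u v]; rewrite !inE ?raddf0// => /eqP u0 /eqP v0.
by rewrite linearP /= u0 v0 scaler0 addr0.
Qed.

Lemma defect_ker_closed : closed [set` defect_ker].
Proof.
rewrite (_ : [set` _] = defect @^-1` [set 0]).
  apply: closed_comp => [? _|]; first exact: continuous_defect.
  exact: accessible_closed_set1 (hausdorff_accessible (@norm_hausdorff _ X)) _.
by apply/seteqP; split => u /=; rewrite inE => /eqP.
Qed.

Definition defect_subspace : closed_subspace X :=
  ClosedSubspace defect_ker_submod defect_ker_closed.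

Lemma defect_subspaceP u :
  reflect (gather u = f (gather u) *: b 0%N) (u \in defect_subspace).
Proof. by rewrite inE subr_eq0; exact: eqP. Qed.

Lemma b0_defect_subspace : b 0%N \in defect_subspace.
Proof. by apply/defect_subspaceP; rewrite gather_id// fb scale1r. Qed.

(** A normalized block vector [b k.+1] can replace [y] up to a small error modulo
    the subspace as soon as its target is close to [gather y], wherever the block
    is; so the block may be taken almost disjoint from [x]. *)
Lemma defect_subspace_almost_rich : almost_rich defect_subspace.
Proof.
move=> x y eps x1 y1 eps0; have eps20 : 0 < eps / 2 by rewrite divr_gt0.
have Ty1 : `|gather y| <= 1 by rewrite -y1 norm_gather.
have [k [dk xk]] := target_dense x (Q0_gather y) Ty1 eps20.
exists (b k.+1); split; first exact: b1.
- (* The error term d k - T y lies in the range of Q 0, where T is the identity. *)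
  have Tb : gather (b k.+1 - y) = target k - gather y.
    by rewrite raddfB /= gather_b.
  have Tw : gather (target k - gather y) = target k - gather y.
    by rewrite gather_id// raddfB /= Q0_target Q0_gather.
  have : b k.+1 - y - (target k - gather y) \in defect_subspace.
    apply/defect_subspaceP; rewrite (_ : gather _ = 0) ?raddf0 ?scale0r//.
    by rewrite [LHS]raddfB /= Tb Tw subrr.
  rewrite -quotient_map_eq0 raddfB subr_eq0 => /eqP byE.
  suff : `|quotient_map defect_subspace (b k.+1 - y)| < eps by [].
  rewrite byE (le_lt_trans (quotient_norm_le _ _))// distrC (lt_trans dk)//.
  by rewrite ltr_pdivrMr// ltr_pMr// ltr1n.
- (* Without its component on the block k.+1, x is L-orthogonal to b k.+1. *)
  have : `|b k.+1 + (x - Q k.+1 x)| = 1 + `|x - Q k.+1 x|.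
    rewrite ((QL k.+1).2 (b k.+1 + _)) raddfD raddfB /= Qb (QL _).1.
    by rewrite subrr addr0 b1 (addrC (b _)) addrK.
  have := (QL k.+1).2 x; have := ler_normB (b k.+1 + x) (Q k.+1 x).
  rewrite x1 addrA; lra.
Qed.

Definition b0_coord (u : X) : R := f (Q 0%N u).

Lemma b0_coord_is_linear : linear b0_coord.
Proof. by move=> c u v; rewrite /b0_coord !linearP. Qed.

HB.instance Definition _ :=
  GRing.isLinear.Build R X R^o _ b0_coord b0_coord_is_linear.

Lemma b0_coord_le_Q0 u : `|b0_coord u| <= `|Q 0%N u|.
Proof. exact: f_le. Qed.

Lemma b0_coord_le u : `|b0_coord u| <= `|u|.
Proof. by rewrite (le_trans (b0_coord_le_Q0 _))// norm_L_projection_le. Qed.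

Lemma b0_coord_b0 : b0_coord (b 0%N) = 1.
Proof. by rewrite /b0_coord Qb fb. Qed.

(** With [r] the norm of [h - Q 0 h], the vector [Q 0 h] differs from
    [b0_coord h *: b 0] by [f (transfer h) *: b 0 - transfer h], of norm at most
    [2 r], while [`|b0_coord h| <= `|Q 0 h| = `|h| - r]. *)
Lemma defect_subspace_dist_b0 h : h \in defect_subspace ->
  `|h - b0_coord h *: b 0%N| <= 3 * (`|h| - `|b0_coord h|).
Proof.
move=> /defect_subspaceP; set c := f _ => hE.
have Q0h : Q 0%N h = c *: b 0%N - transfer h by rewrite -hE /gather addrK.
have cE : c = b0_coord h + f (transfer h).
  by rewrite /c /gather raddfD.
have -> : h - b0_coord h *: b 0%N =
    (h - Q 0%N h) + (f (transfer h) *: b 0%N - transfer h).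
  rewrite Q0h cE scalerDl opprB opprD -!addrA; congr +%R.
  by rewrite !addrA addrNK addrAC subrr add0r.
have := ler_normD (h - Q 0%N h) (f (transfer h) *: b 0%N - transfer h).
have := ler_normB (f (transfer h) *: b 0%N) (transfer h).
have : `|f (transfer h) *: b 0%N| <= `|transfer h| by rewrite normrZ b1 mulr1.
have := norm_transfer h; have := b0_coord_le_Q0 h; have := (QL 0).2 h.
lra.
Qed.

(** Narrowness is tested on the functional [b0_coord], with [y = b 0] and
    [x = - b 0]: a vector [z] close to the subspace with [b0_coord z] close to 1
    is close to [b 0], so [`|z + x|] is small instead of almost 2. *)
Lemma defect_subspace_not_rich : ~ rich defect_subspace.
Proof.
have phic : continuous b0_coord.
  by apply: (@le_continuous_linear _ _ _ _ 1) => u; rewrite mul1r b0_coord_le.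
move=> /(_ b0_coord phic).
have e0 : 0 < 10^-1 :> R by rewrite invr_gt0.
have nb1 : `|- b 0%N| = 1 by rewrite normrN.
move=> /(_ (- b 0%N) (b 0%N) 10^-1 nb1 (b1 0) e0)[z [z1 zT zb]].
have phiz : b0_coord (z - b 0%N) = b0_coord z - 1 by rewrite raddfB /= b0_coord_b0.
have qz : quotient_map defect_subspace (z - b 0%N) = quotient_map defect_subspace z.
  have := b0_defect_subspace; rewrite -quotient_map_eq0 => /eqP qb.
  by rewrite raddfB /= qb subr0.
have {}zT : `|quotient_map defect_subspace z| + `|b0_coord z - 1| < 10^-1.
  by move: zT; rewrite l1sum_normE /= phiz qz.
pose e1 := 10^-1 - (`|quotient_map defect_subspace z| + `|b0_coord z - 1|).
have e10 : 0 < e1 by rewrite subr_gt0.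
have [v vz v_lt] := quotient_norm_lt (quotient_map defect_subspace z) e10.
have {}v_lt : `|v| < 10^-1 - `|b0_coord z - 1|.
  rewrite (lt_le_trans v_lt)// /e1.
  by rewrite -[quotient_norm _]/(`|quotient_map defect_subspace z|); lra.
have zvY : z - v \in defect_subspace.
  by rewrite -quotient_map_eq0 raddfB /= vz subrr.
have phizv : b0_coord (z - v) - 1 = b0_coord z - 1 - b0_coord v.
  by rewrite raddfB /= addrAC.
have H1 := defect_subspace_dist_b0 zvY.
have H2 := ler_normB z v.
have H3 := b0_coord_le v.
have H4 : `|z - b 0%N| <= `|z - v - b0_coord (z - v) *: b 0%N| + `|v| +
    `|b0_coord (z - v) - 1|.
  have -> : z - b 0%N = z - v - b0_coord (z - v) *: b 0%N + v +
      (b0_coord (z - v) - 1) *: b 0%N.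
    rewrite scalerBl scale1r addrAC -addrA.
    by rewrite (addrC _ v) addrA addrACA addrA addrNK subrK.
  rewrite (le_trans (ler_normD _ _))// lerD ?(ler_normD)//.
  by rewrite normrZ b1 mulr1.
have H5 := ler_normB (b0_coord z - 1) (b0_coord v).
rewrite -phizv in H5.
have H6 : 1 - b0_coord (z - v) <= `|b0_coord (z - v) - 1| by rewrite distrC ler_norm.
have H7 := ler_norm (b0_coord (z - v)).
have H8 := normr_ge0 (b0_coord z - 1).
rewrite z1 in H2; lra.
Qed.

Lemma subspace_norm_val (u : subspace_type defect_subspace) : `|u| = `|val u|.
Proof. by []. Qed.

Definition b0_sub : subspace_type defect_subspace := Sub (b 0%N) b0_defect_subspace.

Definition opp_b0_proj (u : subspace_type defect_subspace) :
  subspace_type defect_subspace := - b0_coord (val u) *: b0_sub.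

Lemma opp_b0_proj_is_linear : linear opp_b0_proj.
Proof.
move=> c u v; rewrite /opp_b0_proj.
have -> : b0_coord (val (c *: u + v)) = c * b0_coord (val u) + b0_coord (val v).
  exact: (linearP b0_coord c (val u) (val v)).
by rewrite opprD -mulrN scalerDl scalerA.
Qed.

HB.instance Definition _ := GRing.isLinear.Build R (subspace_type defect_subspace)
  (subspace_type defect_subspace) _ opp_b0_proj opp_b0_proj_is_linear.

Lemma norm_opp_b0_proj u : `|opp_b0_proj u| = `|b0_coord (val u)|.
Proof. by rewrite normrZ normrN subspace_norm_val /= b1 mulr1. Qed.

(** The minimum of the bounds [3 (`|u| - a)] and [`|u| + a], where
    [a = `|b0_coord u|], is largest at [a = `|u| / 2]. *)
Lemma norm_add_opp_b0_proj u : `|u| <= 1 -> `|u + opp_b0_proj u| <= 3 / 2.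
Proof.
move=> u1; have := defect_subspace_dist_b0 (valP u).
have := ler_normD u (opp_b0_proj u); rewrite norm_opp_b0_proj.
have -> : `|u + opp_b0_proj u| = `|val u - b0_coord (val u) *: b 0%N|.
  by rewrite -scaleNr.
by rewrite -subspace_norm_val; lra.
Qed.

Lemma defect_subspace_not_daugavet :
  ~ daugavet_property (subspace_type defect_subspace).
Proof.
have Kc : continuous opp_b0_proj.
  apply: (@le_continuous_linear _ _ _ _ 1) => u.
  by rewrite mul1r norm_opp_b0_proj b0_coord_le.
have K1 : rank_one opp_b0_proj.
  exists b0_sub.
    by rewrite -normr_gt0 subspace_norm_val /= b1.
  apply/seteqP; split => [_ [u _ <-]|_ [c _ <-]] /=.
    by exists (- b0_coord (val u)).
  exists (- c *: b0_sub) => //; rewrite /opp_b0_proj.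
  have -> : b0_coord (val (- c *: b0_sub)) = - c * b0_coord (b 0%N).
    exact: (linearZ_LR b0_coord).
  by rewrite b0_coord_b0 mulr1 opprK.
move=> /(_ opp_b0_proj Kc K1).
have : opnorm (fun u => u + opp_b0_proj u) <= 3 / 2.
  apply: ge_sup => [|_ [u u1 <-]]; last exact: norm_add_opp_b0_proj.
  by exists `|0 + opp_b0_proj 0|, 0 => //=; rewrite normr0.
have : 1 <= opnorm opp_b0_proj.
  apply: ub_le_sup.
    by exists 1 => _ [u u1 <-]; rewrite norm_opp_b0_proj (le_trans (b0_coord_le _)).
  exists b0_sub; first by rewrite /= subspace_norm_val /= b1.
  by rewrite norm_opp_b0_proj /= b0_coord_b0 normr1.
lra.
Qed.

Theorem almost_rich_subspace_not_daugavet : exists Y : closed_subspace X,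
  [/\ almost_rich Y, ~ daugavet_property (subspace_type Y) & ~ rich Y].
Proof.
exists defect_subspace; split.
- exact: defect_subspace_almost_rich.
- exact: defect_subspace_not_daugavet.
- exact: defect_subspace_not_rich.
Qed.

End almost_rich_not_daugavet.


(** * Restriction and integration on L1 *)

Section L1_restriction.
Context d (T : measurableType d) (R : realType).
Variable mu : {measure set T -> \bar R}.
Local Notation L1 := (LspaceType1 mu).

Lemma Lspace1_eq (u v : L1) : (u : T -> R) = v %[ae mu] -> u = v.
Proof.
by move=> uv; rewrite -(repr_Lspace1K u) -(repr_Lspace1K v); apply/class_Lfun1_eqP.
Qed.

Lemma Lspace1D (u v : L1) : ((u + v : L1) : T -> R) = (fun x => u x + v x) %[ae mu].
Proof. exact: (repr_class_Lfun1 (repr_Lspace1 u + repr_Lspace1 v)). Qed.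

Lemma Lspace1Z c (u : L1) : ((c *: u : L1) : T -> R) = (fun x => c * u x) %[ae mu].
Proof. exact: (repr_class_Lfun1 (c *: repr_Lspace1 u)). Qed.

Lemma Lspace1P c (u v : L1) :
  ((c *: u + v : L1) : T -> R) = (fun x => c * u x + v x) %[ae mu].
Proof.
by apply: filterS2 (Lspace1D (c *: u) v) (Lspace1Z c u) => x uvx cux xT;
  rewrite uvx// cux.
Qed.

Lemma Lspace1B (u v : L1) : ((u - v : L1) : T -> R) = (fun x => u x - v x) %[ae mu].
Proof.
rewrite -scaleN1r addrC; apply: filterS (Lspace1P (-1) v u) => x uvx xT.
by rewrite uvx// mulN1r addrC.
Qed.

Lemma norm_Lspace1_ae (u : L1) (f : T -> R) : measurable_fun setT f ->
  (u : T -> R) = f %[ae mu] -> (`|u|%:E = \int[mu]_x `|f x|%:E)%E.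
Proof.
move=> mf uf; rewrite norm_Lspace1E; apply: ge0_ae_eq_integral => //.
- apply: measurableT_comp => //; apply/measurable_EFinP.
  exact: measurable_Lspace1.
- by apply/measurable_EFinP; exact: measurableT_comp.
- by apply: filterS uf => x ux xT; rewrite ux.
Qed.

(** Distances between nested indicators are measures of differences, which turns
    continuity of the measure into convergence in [L1]. *)
Lemma dist_indic (u v : L1) A B : measurable A -> measurable B -> B `<=` A ->
    (u : T -> R) = \1_A %[ae mu] -> (v : T -> R) = \1_B %[ae mu] ->
  (`|u - v|%:E = mu (A `\` B))%E.
Proof.
move=> mA mB BA uA vB.
rewrite (norm_Lspace1_ae (f := \1_(A `\` B))); last 2 first.
- by apply: measurable_indic; exact: measurableD.
- apply: filterS3 (Lspace1B u v) uA vB => x h1 h2 h3 xT.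
  rewrite h1// h2// h3// !indicE in_setD.
  have [xB|xB] := boolP (x \in B); have [xA|xA] := boolP (x \in A).
  + by rewrite subrr.
  + by move: (mem_set (BA _ (set_mem xB))); rewrite (negbTE xA).
  + by rewrite subr0.
  + by rewrite subrr.
rewrite -[A `\` B]setIT -integral_indic//; last exact: measurableD.
apply: eq_integral => x _; rewrite setIT indicE.
by case: (x \in _); rewrite ?normr1 ?normr0.
Qed.

Section restr.
Context (A : set T) (mA : measurable A).

Lemma restr_subproof (u : L1) : exists v : L1, (v : T -> R) = (fun x => u x * \1_A x) %[ae mu].
Proof.
apply: class_integrable; apply: le_integrable (integrable_Lspace1 u) => //.
  by apply/measurable_EFinP; apply: measurable_funM => //; exact: measurable_Lspace1.
move=> x _; rewrite lee_fin normrM ler_piMr// indicE.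
by case: (x \in A); rewrite ?normr1 ?normr0.
Qed.

Definition restr (u : L1) : L1 := projT1 (cid (restr_subproof u)).

Lemma restrE (u : L1) : (restr u : T -> R) = (fun x => u x * \1_A x) %[ae mu].
Proof. exact: projT2 (cid (restr_subproof u)). Qed.

Lemma restr_is_linear : linear restr.
Proof.
move=> c u v; apply: Lspace1_eq.
have cuv : (restr (c *: u + v) : T -> R) =
    (fun x => (c * u x + v x) * \1_A x) %[ae mu].
  apply: filterS2 (restrE (c *: u + v)) (Lspace1P c u v) => x h1 h2 xT.
  by rewrite h1// h2.
have := Lspace1P c (restr u) (restr v) => curv.
have H : ((c *: restr u + restr v : L1) : T -> R) =
    (fun x => c * (u x * \1_A x) + v x * \1_A x) %[ae mu].
  by apply: filterS3 curv (restrE u) (restrE v) => x h1 h2 h3 xT;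
    rewrite h1// h2// h3.
by apply: filterS2 cuv H => x h1 h2 xT; rewrite h1// h2// mulrDl mulrA.
Qed.

HB.instance Definition _ := GRing.isLinear.Build R L1 L1 _ restr restr_is_linear.

Lemma restrK u : restr (restr u) = restr u.
Proof.
apply: Lspace1_eq; apply: filterS2 (restrE (restr u)) (restrE u) => x h1 h2 xT.
by rewrite h1// h2// -mulrA indicE; case: (x \in A); rewrite ?mulr1 ?mulr0.
Qed.

Lemma norm_restr u : `|u| = `|restr u| + `|u - restr u|.
Proof.
have mu_ := measurable_Lspace1 u.
have muA : measurable_fun setT (fun x => u x * \1_A x).
  exact: measurable_funM.
have ruC : ((u - restr u : L1) : T -> R) = (fun x => u x * \1_(~` A) x) %[ae mu].
  apply: filterS2 (Lspace1B u (restr u)) (restrE u) => x ux rux xT.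
  rewrite ux// rux// !indicE in_setC.
  by case: (x \in A); rewrite ?mulr1 ?mulr0 ?subrr ?subr0.
have muC : measurable_fun setT (fun x => u x * \1_(~` A) x).
  by apply: measurable_funM => //; apply: measurable_indic; exact: measurableC.
apply: EFin_inj; rewrite EFinD (norm_Lspace1_ae muA (restrE u)).
rewrite (norm_Lspace1_ae muC ruC) norm_Lspace1E -ge0_integralD//.
- apply: eq_integral => x _; rewrite -EFinD; congr EFin.
  rewrite !indicE in_setC.
  by case: (x \in A); rewrite ?mulr1 ?mulr0 ?normr0 ?addr0 ?add0r.
- by apply/measurable_EFinP; exact: measurableT_comp.
- by apply/measurable_EFinP; exact: measurableT_comp.
Qed.

Lemma restr_L_projection : L_projection restr.
Proof. by split; [exact: restrK | exact: norm_restr]. Qed.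

End restr.

Lemma restr_disjoint A B (mA : measurable A) (mB : measurable B) u :
  A `&` B = set0 -> restr mA (restr mB u) = 0.
Proof.
move=> AB0; apply: Lspace1_eq.
rewrite -(scale0r u).
apply: filterS3 (restrE mA (restr mB u)) (restrE mB u) (Lspace1Z 0 u) => x h1 h2 h3 xT.
have : \1_(A `&` B) x = 0 :> R by rewrite AB0 indicE in_set0.
by rewrite indicI /= => AB; rewrite h1// h2// h3// mul0r -mulrA (mulrC (\1_B x)) AB mulr0.
Qed.

Definition L1_int (u : L1) : R := \int[mu]_x u x.

Lemma L1_int_ae (u : L1) (f : T -> R) : measurable_fun setT f ->
  (u : T -> R) = f %[ae mu] -> L1_int u = \int[mu]_x f x.
Proof.
move=> mf uf; congr fine; apply: ae_eq_integral => //.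
- by apply/measurable_EFinP; exact: measurable_Lspace1.
- exact/measurable_EFinP.
- by apply: filterS uf => x ux xT; rewrite /= ux.
Qed.

Lemma L1_int_is_linear : linear (L1_int : L1 -> R^o).
Proof.
move=> c u v.
rewrite (L1_int_ae _ (Lspace1P c u v)); last first.
  apply: measurable_funD; last exact: measurable_Lspace1.
  by apply: measurable_funM => //; exact: measurable_Lspace1.
have iu := integrable_Lspace1 u; have iv := integrable_Lspace1 v.
rewrite RintegralD//; first by rewrite RintegralZl.
exact: (integrableZl measurableT c iu).
Qed.

HB.instance Definition _ := GRing.isLinear.Build R L1 R^o _
  (L1_int : L1 -> R^o) L1_int_is_linear.

Lemma L1_int_le (u : L1) : `|L1_int u| <= `|u|.
Proof.
have iu := integrable_Lspace1 u.
rewrite (le_trans (le_normr_Rintegral _ _))// -lee_fin norm_Lspace1E fineK//.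
apply: integrable_fin_num => //; exact: (integrable_abse iu).
Qed.

Section normalized_indicator.
Context (A : set T) (mA : measurable A).
Context (A0 : (0 < mu A)%E) (Aoo : (mu A < +oo)%E).

Lemma indic_L1_ex : exists u : L1, (u : T -> R) = \1_A %[ae mu].
Proof.
apply: class_integrable; apply/integrableP; split.
  exact/measurable_EFinP.
rewrite (eq_integral (fun x => (\1_A x)%:E)); last first.
  by move=> x _; rewrite gee0_abs// lee_fin.
by rewrite integral_indic// setIT.
Qed.

Lemma unit_bump : exists u : L1, [/\ restr mA u = u, `|u| = 1 & L1_int u = 1].
Proof.
have [v vA] := indic_L1_ex.
have m0 : 0 < fine (mu A) by rewrite fine_gt0// A0.
have mfin : mu A = (fine (mu A))%:E by rewrite fineK// ge0_fin_numE.
have nv : `|v| = fine (mu A).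
  apply: EFin_inj; rewrite -mfin (norm_Lspace1_ae _ vA)//.
  rewrite -[A in RHS]setIT -integral_indic//; apply: eq_integral => x _.
  by rewrite ger0_norm.
have iv : L1_int v = fine (mu A).
  by rewrite (L1_int_ae _ vA)// /Rintegral integral_indic// setIT.
exists ((fine (mu A))^-1 *: v); split.
- rewrite linearZ /=; congr (_ *: _); apply: Lspace1_eq.
  apply: filterS2 (restrE mA v) vA => x h1 h2 xT; rewrite h1// h2//.
  by rewrite indicE; case: (x \in A); rewrite ?mulr1 ?mulr0.
- by rewrite normrZ nv ger0_norm ?invr_ge0 ?ltW// mulVf ?gt_eqF.
- rewrite -[L1_int _]/((L1_int : L1 -> R^o) _) linearZ /= iv.
  by rewrite -[_ *: _]/(_ * _) mulVf ?gt_eqF.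
Qed.

End normalized_indicator.

End L1_restriction.

(** * Closed subspaces containing the indicators of a generating pi-system *)

Section L1_density.
Context d (T : measurableType d) (R : realType).
Variable mu : {measure set T -> \bar R}.
Hypothesis mu_fin : (mu setT < +oo)%E.
Local Notation L1 := (LspaceType1 mu).

Let mu_lty A : measurable A -> (mu A < +oo)%E.
Proof. by move=> mA; rewrite (le_lt_trans _ mu_fin)// le_measure// inE. Qed.

Context (S : set L1).
Hypothesis S0 : S 0.
Hypothesis S_lin : forall c u v, S u -> S v -> S (c *: u + v).
Hypothesis S_lim : forall u, (forall e : R, 0 < e -> exists2 v, S v & `|u - v| < e) -> S u.

Definition indic_in (A : set T) : Prop :=
  measurable A /\ forall u : L1, (u : T -> R) = \1_A %[ae mu] -> S u.

(** Differences of nested sets are handled by linearity and increasing unions by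
    closedness of [S], since the measure is finite. *)
Lemma indic_in_lambda_system : indic_in setT -> lambda_system setT indic_in.
Proof.
move=> ST; split => // [A B BA [mA SA] [mB SB]|F Fnd SF].
  split=> [|u uAB]; first exact: measurableD.
  have [v vA] := indic_L1_ex mA (mu_lty mA).
  have [w wB] := indic_L1_ex mB (mu_lty mB).
  rewrite (_ : u = -1 *: w + v); first by apply: S_lin; [exact: SB|exact: SA].
  apply: Lspace1_eq.
  have H : ((-1 *: w + v : L1) : T -> R) = (fun x => - \1_B x + \1_A x) %[ae mu].
    by apply: filterS3 (Lspace1P (-1) w v) wB vA => x h1 h2 h3 xT;
      rewrite h1// h2// h3// mulN1r.
  apply: filterS2 uAB H => x h1 h2 xT; rewrite h1// h2// !indicE in_setD.
  have [xB|xB] := boolP (x \in B); last by rewrite andbT oppr0 add0r.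
  by rewrite (mem_set (BA _ (set_mem xB))) andbF addNr.
have mF i : measurable (F i) by case: (SF i).
have mU : measurable (\bigcup_i F i) by exact: bigcup_measurable.
split=> // u uU; apply: S_lim => e e0.
have mUF i : measurable (\bigcup_i F i `\` F i) by exact: measurableD.
have UF0 : \bigcap_n (\bigcup_i F i `\` F n) = set0.
  by rewrite -subset0 => x /= xF; have [[n _ Fnx] _] := xF 0%N I; have [] := xF n I.
have := @nonincreasing_cvg_mu _ _ _ mu (fun n => \bigcup_i F i `\` F n).
rewrite UF0 measure0 => /(_ (mu_lty (mUF _)) mUF measurable0).
have UFni : {homo (fun n => \bigcup_i F i `\` F n) : n m / (n <= m)%N >-> (m <= n)%O}.
  by move=> n m nm; apply/subsetPset; apply: setDS; apply/subsetPset; exact: Fnd.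
move=> /(_ UFni) /fine_cvgP[_ /cvgr0_norm_lt /(_ _ e0)[n _ /(_ n (leqnn n)) /= ne]].
have [v vF] := indic_L1_ex (mF n) (mu_lty (mF n)).
exists v; first by case: (SF n) => _; exact.
have Fn : F n `<=` \bigcup_i F i by exact: bigcup_sup.
rewrite (le_lt_trans _ ne)// ger0_norm ?fine_ge0//.
by rewrite -(dist_indic mU (mF n) Fn uU vF).
Qed.

(** Simple functions are dense in [L1], and each is a finite combination of
    indicators of its level sets. *)
Lemma indic_in_full : (forall A, measurable A -> indic_in A) -> forall u, S u.
Proof.
move=> SA u; apply: S_lim => e e0.
have [g [_ _ /fine_cvgP[_ /cvgr0_norm_lt /(_ _ e0)[n _ /(_ n (leqnn n)) /= ne]]]] :=
  approximation_sfun_integrable measurableT (integrable_Lspace1 u).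
have mg y : measurable (g n @^-1` [set y]) by exact: measurable_sfunP.
have [v Sv vg] : exists2 v : L1, S v & (v : T -> R) = (g n : T -> R) %[ae mu].
  suff [v Sv vg] : exists2 v : L1, S v & (v : T -> R) = (fun x =>
      \sum_(y <- finmap.enum_fset (fset_set (range (g n))))
        y * \1_(g n @^-1` [set y]) x) %[ae mu].
    exists v => //; apply: filterS vg => x + xT => ->//.
    by rewrite [RHS]fimfunE fsbig_finite.
  elim: (finmap.enum_fset _) => [|y s [v Sv vs]].
    exists 0 => //; rewrite -(scale0r (0 : L1)).
    by apply: filterS (Lspace1Z 0 (0 : L1)) => x h xT; rewrite h// mul0r big_nil.
  have [w wy] := indic_L1_ex (mg y) (mu_lty (mg y)).
  exists (y *: w + v); first by apply: S_lin => //; case: (SA _ (mg y)) => _; exact.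
  by apply: filterS3 (Lspace1P y w v) wy vs => x h1 h2 h3 xT;
    rewrite h1// h2// h3// big_cons.
exists v => //; rewrite (le_lt_trans _ ne)// ger0_norm; last first.
  by apply: fine_ge0; exact: integral_ge0.
have uv : (`|u - v|%:E = \int[mu]_x `|(u x)%:E - (g n x)%:E|)%E.
  rewrite norm_Lspace1BE; apply: ge0_ae_eq_integral => //.
  - apply: measurableT_comp => //; apply/measurable_EFinP.
    by apply: measurable_funB; exact: measurable_Lspace1.
  - apply: measurableT_comp => //; apply: emeasurable_funB.
      by apply/measurable_EFinP; exact: measurable_Lspace1.
    exact/measurable_EFinP.
  - by apply: filterS vg => x vx xT; rewrite vx// EFinB.
by rewrite -uv.
Qed.

Lemma pi_system_dense (G : set (set T)) : setI_closed G ->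
    measurable = <<s G >> -> indic_in setT -> G `<=` indic_in ->
  forall u, S u.
Proof.
move=> GI Gm ST SG; apply: indic_in_full => A mA.
apply: (lambda_system_subset GI (indic_in_lambda_system ST) SG) => //.
by rewrite -Gm.
Qed.

End L1_density.

(** * Separability of L1[0, 1] *)

Section rational_span.
Context (R : realType) (V : normedModType R) (J : Type) (g : J -> V).

Definition rat_comb (s : seq (rat * J)) : V := \sum_(p <- s) ratr p.1 *: g p.2.

Definition rat_span_closure (u : V) : Prop :=
  forall e : R, 0 < e -> exists s, `|u - rat_comb s| < e.

Lemma rat_span_closure0 : rat_span_closure 0.
Proof. by move=> e e0; exists [::]; rewrite /rat_comb big_nil subr0 normr0. Qed.

Lemma rat_combZ r s : rat_comb [seq (r * p.1, p.2) | p <- s] = ratr r *: rat_comb s.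
Proof.
rewrite /rat_comb big_map scaler_sumr; apply: eq_bigr => p _ /=.
by rewrite rmorphM scalerA.
Qed.

Lemma rat_span_closure_lin c u v : rat_span_closure u -> rat_span_closure v ->
  rat_span_closure (c *: u + v).
Proof.
move=> Su Sv e e0; have e40 : 0 < e / 4 by rewrite divr_gt0.
have u10 : 0 < `|u| + 1 by rewrite ltr_wpDl.
have [r] : exists r : rat, ratr r \in `]c, (c + e / 4 / (`|u| + 1))[.
  by apply: rat_in_itvoo; rewrite ltrDl divr_gt0.
rewrite in_itv /= => /andP[cr rc].
have r10 : 0 < `|ratr r : R| + 1 by rewrite ltr_wpDl.
have [s us] := Su _ (divr_gt0 e40 r10).
have [t vt] := Sv _ e40.
exists ([seq (r * p.1, p.2) | p <- s] ++ t).
rewrite {1}/rat_comb big_cat /= -![\sum_(_ <- _) _]/(rat_comb _) rat_combZ.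
have -> : c *: u + v - (ratr r *: rat_comb s + rat_comb t) =
    (c - ratr r) *: u + ratr r *: (u - rat_comb s) + (v - rat_comb t).
  by rewrite scalerBl scalerBr subrKA opprD addrACA.
have := ler_normD ((c - ratr r) *: u + ratr r *: (u - rat_comb s)) (v - rat_comb t).
have := ler_normD ((c - ratr r) *: u) (ratr r *: (u - rat_comb s)).
rewrite (normrZ (c - _)) (normrZ (ratr r)).
have : `|c - ratr r| * `|u| <= e / 4.
  apply: (@le_trans _ _ (e / 4 / (`|u| + 1) * (`|u| + 1))); last by rewrite divfK// gt_eqF.
  rewrite ler_pM// ?lerDl// distrC ger0_norm; last by rewrite subr_ge0 ltW.
  by rewrite lerBlDl ltW.
have : `|ratr r| * `|u - rat_comb s| <= e / 4.
  apply: (@le_trans _ _ ((`|ratr r| + 1) * (e / 4 / (`|ratr r| + 1)))).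
    by rewrite ler_pM// ?lerDl// ltW.
  by rewrite mulrC divfK// gt_eqF.
lra.
Qed.

Lemma rat_span_closure_lim u :
  (forall e : R, 0 < e -> exists2 v, rat_span_closure v & `|u - v| < e) ->
  rat_span_closure u.
Proof.
move=> Su e e0; have e20 : 0 < e / 2 by rewrite divr_gt0.
have [v Sv uv] := Su _ e20; have [s vs] := Sv _ e20; exists s.
by rewrite (le_lt_trans (ler_distD v _ _))// (splitr e) ltrD.
Qed.

End rational_span.

Section L1_separable.
Context (R : realType).
Local Notation mu := (lebesgue01 R).

Lemma lebesgue01_fin : (mu setT < +oo)%E.
Proof.
rewrite /lebesgue01 /= /mrestr setTI lebesgue_measure_itv /= lte_fin ltr01.
by rewrite -EFinB ltry.
Qed.

Lemma lebesgue01_lty (A : set (measurableTypeR R)) : measurable A -> (mu A < +oo)%E.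
Proof. by move=> mA; rewrite (le_lt_trans _ lebesgue01_fin)// le_measure// inE. Qed.

Lemma measurable_ray (x : R) : measurable (`]x, +oo[%classic : set (measurableTypeR R)).
Proof. exact: measurable_itv. Qed.

Definition ray (q : rat) : L1 R :=
  projT1 (cid (indic_L1_ex (measurable_ray (ratr q)) (lebesgue01_lty (measurable_ray _)))).

Lemma rayE q : (ray q : R -> R) = \1_(`]ratr q, +oo[) %[ae mu].
Proof. by rewrite /ray; case: cid. Qed.

(** A ray with a real endpoint is close to one with a slightly larger rational
    endpoint. *)
Lemma approx_by_ray (x : R) (u : L1 R) :
  (u : R -> R) = \1_(`]x, +oo[) %[ae mu] -> rat_span_closure ray u.
Proof.
move=> ux e e0.
have [q] : exists q : rat, ratr q \in `]x, (x + e)[.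
  by apply: rat_in_itvoo; rewrite ltrDl.
rewrite in_itv /= => /andP[xq qe].
exists [:: (1, q)]; rewrite /rat_comb big_seq1 /= rmorph1 scale1r.
have qx : `]ratr q, +oo[ `<=` (`]x, +oo[ : set R).
  by move=> y /=; rewrite !in_itv /= !andbT; exact: lt_trans.
rewrite -lte_fin (dist_indic (measurable_ray x) (measurable_ray (ratr q)) qx ux (rayE q)).
apply: (@le_lt_trans _ _ (lebesgue_measure (`]x, (ratr q : R)]%classic : set R))).
  apply: le_measure; rewrite ?inE.
  - by apply: measurableI => //; apply: measurableD; exact: measurable_ray.
  - exact: measurable_itv.
  - by move=> y /= [[]]; rewrite !in_itv /= !andbT => -> /negP; rewrite -leNgt.
by rewrite lebesgue_measure_itv /= lte_fin xq -EFinB lte_fin ltrBlDl.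
Qed.

Lemma ray_dense (u : L1 R) : rat_span_closure ray u.
Proof.
have rayS x : indic_in (rat_span_closure ray) (`]x, +oo[%classic : set (measurableTypeR R)).
  by split; [exact: measurable_ray | exact: approx_by_ray].
refine (pi_system_dense lebesgue01_fin (rat_span_closure0 ray)
  (@rat_span_closure_lin _ _ _ ray) (@rat_span_closure_lim _ _ _ ray)
  (G := @RGenOInfty.G R) _ _ _ _ u).
- move=> _ _ [x ->] [y ->]; exists (Num.max x y).
  by apply/seteqP; split => z /=; rewrite !in_itv /= !andbT gt_max => /andP.
- exact: (@RGenOInfty.measurableE R).
- (* The measure lives on [0, 1], where the ray from -1 agrees with the line. *)
  split=> // v vT; apply: (@approx_by_ray (-1)).
  have : mu.-negligible (~` `]-1, +oo[ : set (measurableTypeR R)).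
    exists (~` `]-1, +oo[); split => //; first by apply: measurableC; exact: measurable_ray.
    rewrite /lebesgue01 /= /mrestr (_ : _ `&` _ = set0) ?measure0// -subset0 => x /=.
    rewrite !in_itv /= andbT => -[nx /andP[x0 _]]; apply: nx.
    by rewrite (lt_le_trans _ x0)// oppr_lt0.
  move=> H; have {}H : {ae mu, forall x, `]-1, +oo[%classic x} by [].
  apply: filterS2 vT H => x h1 h2 xT; rewrite h1// !indicE in_setT.
  by rewrite mem_set.
- by move=> _ [x ->].
Qed.

End L1_separable.

(** * Dyadic blocks and the example in L1[0, 1] *)

Section dyadic.
Context (R : realType).

Definition dyadic k : set R := `](2^-1 ^+ k.+1), (2^-1 ^+ k)[.

Lemma measurable_dyadic k : measurable (dyadic k : set (measurableTypeR R)).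
Proof. exact: measurable_itv. Qed.

Lemma dyadic_disjoint j k : j != k -> dyadic j `&` dyadic k = set0.
Proof.
wlog jk : j k / (j < k)%N.
  move=> H; rewrite neq_ltn => /orP[] jk; first by rewrite H// ltn_eqF.
  by rewrite setIC H// ltn_eqF.
move=> _; rewrite -subset0 => x /= []; rewrite /dyadic /= !in_itv /=.
move=> /andP[jx _] /andP[_ xk]; have := lt_trans jx xk.
rewrite ltNge => /negP; apply.
by rewrite ler_wiXn2l// ?invr_ge0// invf_le1// ler1n.
Qed.

Lemma lebesgue01_dyadic k : lebesgue01 R (dyadic k) = (2^-1 ^+ k.+1)%:E.
Proof.
rewrite /lebesgue01 /= /mrestr setIidl.
  rewrite lebesgue_measure_itv /= lte_fin ltr_iXn2l ?invf_lt1 ?invr_gt0 ?ltr1n// leqnn.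
  by rewrite -EFinB; congr EFin; rewrite exprS; field.
move=> x; rewrite /dyadic /= !in_itv /= => /andP[kx xk].
rewrite (le_trans _ (ltW kx)) ?exprn_ge0 ?invr_ge0//=.
by rewrite (le_trans (ltW xk))// exprn_ile1 ?invr_ge0// invf_le1// ler1n.
Qed.

Lemma lebesgue01_dyadic_gt0 k : (0 < lebesgue01 R (dyadic k))%E.
Proof. by rewrite lebesgue01_dyadic lte_fin exprn_gt0// invr_gt0. Qed.

End dyadic.


Lemma L1_almost_rich_subspace_not_daugavet (R : realType) :
  exists Y : closed_subspace (L1 R),
    [/\ almost_rich Y, ~ daugavet_property (subspace_type Y) & ~ rich Y].
Proof.
have bump k := unit_bump (measurable_dyadic k) (lebesgue01_dyadic_gt0 R k)
  (lebesgue01_lty (measurable_dyadic k)).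
have [b bP] := choice bump.
pose Q k : {linear L1 R -> L1 R} := restr (measurable_dyadic k).
pose f : {linear L1 R -> R^o} := @L1_int _ _ R (lebesgue01 R).
apply: (@almost_rich_subspace_not_daugavet R (L1 R) Q _ _ f _ b _ _ _ _ (rat_comb (@ray R))).
- by move=> k; exact: restr_L_projection.
- by move=> j k u jk; apply: restr_disjoint; exact: dyadic_disjoint.
- exact: L1_int_le.
- by move=> k; case: (bP k).
- by move=> k; case: (bP k).
- by move=> k; case: (bP k).
- by move=> u e e0; exact: ray_dense.
Qed.

Theorem theorem6p4 (R : realType) :
  (exists Y : closed_subspace (L1 R),
     [/\ almost_rich Y, ~ daugavet_property (subspace_type Y) & ~ rich Y]) /\
  ~ (forall (Z : completeNormedModType R) (T : {linear L1 R -> Z}),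
       continuous T -> (strong_daugavet T <-> narrow T)).
Proof.
split; first exact: L1_almost_rich_subspace_not_daugavet.
move=> strong_narrow.
have [Y [Yar _ Ynr]] := L1_almost_rich_subspace_not_daugavet R.
apply: Ynr; apply/strong_narrow => //.
exact: quotient_map_continuous.
Qed.
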